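(* Let $(X,\mu)$ be a standard atomless probability space, let $T\in\mathrm{Aut}(X,[\mu])$ be ergodic, and assume there exists a $\sigma$-finite measure $\nu\sim\mu$ which is preserved by $T$. If $A,B\subset X$ are Borel subsets such that $\nu(A)<\nu(B)$, then there is an element $S\in[T]_{\mathrm{com}}$ such that $S(A)\subset B$.
   Context: $\mathrm{Aut}(X,[\mu])$ is the group of measurable bijections $T:X\to X$ such that $T_*\mu$ and $\mu$ have the same null sets, two such maps being identified if they agree almost everywhere. All equalities and inclusions are understood up to null sets. $\nu\sim\mu$ means that $\nu$ and $\mu$ have the same null sets. $T$ is ergodic if every $T$-invariant Borel set is null or conull; $T$ is aperiodic if almost every $T$-orbit is infinite (ergodic transformations are aperiodic since $\mu$ is atomless). Let $T\in\mathrm{Aut}(X,[\mu])$ be aperiodic. The full group $[T]$ is the group of $S\in\mathrm{Aut}(X,[\mu])$ such that for a.e. $x$, $S(x)=T^{c_S(x)}(x)$ for some integer $c_S(x)$; the a.e. uniquely defined measurable map $c_S:X\to\mathbb Z$ is the cocycle of $S$. Let $\mathrm{Sym}(\mathbb Z,\mathbb N)$ be the group of permutations $\sigma$ of $\mathbb Z$ with $|\sigma(\mathbb N)\triangle\mathbb N|<\infty$. For $S\in[T]$, $x\in X$, define the permutation $\Phi(S)(x)$ of $\mathbb Z$ by $\Phi(S)(x)(n)=n+c_S(T^n(x))$. The commensurating full group is $$[T]_{\mathrm{com}}=\{S\in[T]:\ \Phi(S)(x)\in\mathrm{Sym}(\mathbb Z,\mathbb N)\text{ for a.e. }x\}.$$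 *)

(* Defs.v *)
From HB Require Import structures.
From mathcomp Require Import all_boot all_order all_algebra.
From mathcomp Require Import all_classical all_reals all_analysis.

Set Implicit Arguments.
Unset Strict Implicit.
Unset Printing Implicit Defensive.

Import Order.TTheory GRing.Theory Num.Theory.
Import numFieldNormedType.Exports.

Local Open Scope classical_set_scope.
Local Open Scope ring_scope.

(* Separable complete metric space. *)
Definition polish (R : realType) (P : metricType R) : Prop :=
  (exists2 D : set P, countable D & dense D) /\
  (forall F : set_system P, ProperFilter F -> cauchy F ->
     exists p : P, F --> p).

Definition standard_borel (R : realType) d (X : measurableType d) : Prop :=
  exists2 P : metricType R, polish P &
  exists2 f : X -> P, bijective f &
    @measurable d X = preimage_set_system setT f <<s @open P >>.

Section nonsingular.
Context d (X : measurableType d) (R : realType).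
Implicit Types mu nu : {measure set X -> \bar R}.

Definition atomless mu : Prop :=
  forall E, measurable E -> (0 < mu E)%E ->
    exists F, [/\ measurable F, F `<=` E, (0 < mu F)%E & (mu F < mu E)%E].

Definition same_null_sets (m1 m2 : set X -> \bar R) : Prop :=
  m1 `<< m2 /\ m2 `<< m1.

(* Representatives of the elements of Aut(X,[mu]): the quotient by a.e.
   equality is not taken, and every notion below is invariant under it.  The
   inverse is stored because integer powers are needed; its measurability is
   automatic on a standard Borel space. *)
Record aut mu := Aut {
  aut_fun :> X -> X;
  aut_inv : X -> X;
  aut_funK : cancel aut_fun aut_inv;
  aut_invK : cancel aut_inv aut_fun;
  measurable_aut_fun : measurable_fun setT aut_fun;
  measurable_aut_inv : measurable_fun setT aut_inv;
  aut_null : same_null_sets (pushforward mu aut_fun) mu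
}.

Definition aut_pow mu (T : aut mu) (k : int) : X -> X :=
  match k with
  | Posz n => iter n T
  | Negz n => iter n.+1 (aut_inv T)
  end.

(* Invariance is understood up to null sets. *)
Definition ergodic mu (T : aut mu) : Prop :=
  forall E, measurable E -> mu ((T @^-1` E) `+` E) = 0%E ->
    mu E = 0%E \/ mu (~` E) = 0%E.

Definition preserves nu (T : X -> X) : Prop :=
  forall E, measurable E -> pushforward nu T E = nu E.

Definition full_group mu (T : aut mu) : set (aut mu) :=
  [set S | {ae mu, forall x, exists k : int, S x = aut_pow T k x}].

(* Measurability is with respect to the discrete sigma-algebra on int. *)
Definition is_cocycle mu (T S : aut mu) (c : X -> int) : Prop :=
  (forall K : set int, measurable (c @^-1` K)) /\
  {ae mu, forall x, S x = aut_pow T (c x) x}.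

Definition Sym_int_nat : set (int -> int) :=
  [set s | bijective s /\
    finite_set ((s @` [set n | 0 <= n]) `+` [set n : int | 0 <= n])].

Definition Phi mu (T : aut mu) (c : X -> int) (x : X) : int -> int :=
  fun n => n + c (aut_pow T n x).

(* When T is aperiodic the cocycle is unique up to a null set, hence so is the
   a.e. value of Phi, and quantifying existentially over c loses nothing. *)
Definition com_full_group mu (T : aut mu) : set (aut mu) :=
  [set S | full_group T S /\
    exists2 c, is_cocycle T S c & {ae mu, forall x, Sym_int_nat (Phi T c x)}].

End nonsingular.

(* Main.v *)
Require Import Defs.
From HB Require Import structures.
From mathcomp Require Import all_boot all_order all_algebra.
From mathcomp Require Import all_classical all_reals all_analysis.
From mathcomp Require Import zify.

Set Implicit Arguments.
Unset Strict Implicit.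
Unset Printing Implicit Defensive.

Import Order.TTheory GRing.Theory Num.Theory.
Import numFieldNormedType.Exports.

Local Open Scope classical_set_scope.
Local Open Scope ring_scope.

(** Replacing [A] by [A `\` B] and [B] by [B `\` A], one may assume that the two
sets are disjoint: [nu A] is finite, so the strict inequality survives, and the
map [S] built below fixes [A `&` B].  Read
each orbit of [T] as a sequence in which a point of [A] opens a parenthesis and
a point of [B] closes one, and let [S] exchange the two ends of each matched
pair.  The matching is built greedily by distance: at stage [n], a point [x] of
[A] is matched with [T^(n+1) x] if this lies in [B] and neither of the two has
been matched before.

Each stage is a partial translation by a power of [T], hence preserves [nu];
if almost every point of [B] were matched, this would give [nu B <= nu A].  So
the set [V] of unmatched points of [B] is not null ([unmatched_right_neq0]),
and by ergodicity almost every orbit meets [V].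

An unmatched [v] in [V] settles both remaining points.
- No matched pair straddles [v]: a point of [A] lying before [v] and still free
  at the stage that separates it from [v] would have been matched with [v]
  ([source_no_unmatched]).  So [S] preserves each side of [v] in the orbit,
  and along the orbit it moves only finitely many points across any given
  position: [S] is commensurating ([displacement_Sym]).
- For the same reason no unmatched point of [A] precedes [v] in its orbit.  The
  unmatched points of [A] in an orbit thus have a first element, and the set of
  these first elements meets each orbit at most once.  Such a set is null for
  an ergodic transformation of an atomless space ([wandering_null]): a subset
  of intermediate measure would have a saturation neither null nor conull.  So
  almost every point of [A] is matched, that is, sent into [B]. *)

(** * Powers of a nonsingular transformation and its wandering sets *)

Section powers.
Context {d : measure_display} {X : measurableType d} {R : realType}.
Context {mu : {measure set X -> \bar R}} (T : aut mu).

Lemma aut_powS k x : aut_pow T (k + 1) x = T (aut_pow T k x).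
Proof.
case: k => [n|[|n]].
- by rewrite -PoszD addn1.
- by rewrite /= aut_invK.
- by rewrite (_ : Negz n.+1 + 1 = Negz n) /= ?aut_invK //; lia.
Qed.

Lemma aut_powD m n x : aut_pow T (m + n) x = aut_pow T m (aut_pow T n x).
Proof.
elim/int_ind: m => [|m IH|m IH]; first by rewrite add0r.
- rewrite (_ : m.+1%:Z + n = m%:Z + n + 1); last lia.
  by rewrite aut_powS IH -aut_powS; congr aut_pow; lia.
- apply: (can_inj (aut_funK T)); rewrite -!aut_powS.
  rewrite (_ : - m.+1%:Z + n + 1 = - m%:Z + n); last lia.
  by rewrite IH; congr aut_pow; lia.
Qed.

Lemma aut_powNK k : cancel (aut_pow T k) (aut_pow T (- k)).
Proof. by move=> x; rewrite -aut_powD addNr. Qed.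

Lemma aut_powKN k : cancel (aut_pow T (- k)) (aut_pow T k).
Proof. by move=> x; rewrite -aut_powD subrr. Qed.

Lemma preimage_aut_powS k E :
  aut_pow T (k + 1) @^-1` E = aut_pow T k @^-1` (T @^-1` E).
Proof. by apply/seteqP; split=> x; rewrite /preimage /mkset aut_powS. Qed.

Lemma preimage_aut_powB k E :
  aut_pow T (k - 1) @^-1` E = aut_pow T k @^-1` (aut_inv T @^-1` E).
Proof.
have e x : aut_pow T (k - 1) x = aut_inv T (aut_pow T k x).
  by rewrite -[in RHS](subrK 1 k) aut_powS aut_funK.
by apply/seteqP; split=> x; rewrite /preimage /mkset e.
Qed.

Lemma measurable_aut_pow_preimage k E :
  measurable E -> measurable (aut_pow T k @^-1` E).
Proof.
elim/int_ind: k E => [|k IH|k IH] E mE //.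
- rewrite -addn1 PoszD preimage_aut_powS; apply: IH.
  by rewrite -[_ @^-1` _]setTI; exact: (measurable_aut_fun T).
- rewrite -addn1 PoszD opprD preimage_aut_powB; apply: IH.
  by rewrite -[_ @^-1` _]setTI; exact: (measurable_aut_inv T).
Qed.

Lemma aut_pow_null k E :
  measurable E -> mu E = 0%E -> mu (aut_pow T k @^-1` E) = 0%E.
Proof.
have [dom1 dom2] := aut_null T.
elim/int_ind: k E => [|k IH|k IH] E mE E0 //.
- rewrite -addn1 PoszD preimage_aut_powS.
  apply: IH; first exact: (measurable_aut_pow_preimage 1).
  by apply: (dom1 E) => //; exact/measure0_null_setP.
- rewrite -addn1 PoszD opprD preimage_aut_powB.
  have mTE : measurable (aut_inv T @^-1` E).
    exact: (measurable_aut_pow_preimage (Negz 0)).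
  apply: IH => //; apply: (dom2 (aut_inv T @^-1` E)) => // F mF FE.
  have mTF : measurable (T @^-1` F) by exact: (measurable_aut_pow_preimage 1).
  apply: (subset_measure0 mTF mE _ E0).
  by move=> x /FE; rewrite /preimage/= aut_funK.
Qed.

Lemma preserves_aut_pow (nu : {measure set X -> \bar R}) :
  preserves nu T -> forall k E, measurable E -> nu (aut_pow T k @^-1` E) = nu E.
Proof.
move=> nuT.
have pos (n : nat) E : measurable E -> nu (aut_pow T n @^-1` E) = nu E.
  elim: n E => [//|n IH] E mE.
  rewrite -addn1 PoszD preimage_aut_powS IH; first exact: nuT.
  exact: (measurable_aut_pow_preimage 1).
case=> [n E|n E mE]; first exact: pos.
rewrite -(pos n.+1); last exact: measurable_aut_pow_preimage.
congr (nu _); apply/seteqP; split=> x;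
  by rewrite /preimage /mkset NegzE aut_powNK.
Qed.

Definition saturation (E : set X) : set X := \bigcup_k aut_pow T k @^-1` E.

Lemma measurable_saturation E : measurable E -> measurable (saturation E).
Proof.
move=> mE; apply: countable_bigcupT_measurable => // k.
exact: measurable_aut_pow_preimage.
Qed.

Lemma saturation_null E :
  measurable E -> mu E = 0%E -> mu (saturation E) = 0%E.
Proof.
move=> mE E0; apply/measure_negligible; first exact: measurable_saturation.
rewrite (_ : saturation E = \bigcup_(n : nat) aut_pow T (n%:Z) @^-1` E `|`
                            \bigcup_(n : nat) aut_pow T (Negz n) @^-1` E).
  have neg k : mu.-negligible (aut_pow T k @^-1` E).
    apply/negligibleP; first exact: measurable_aut_pow_preimage.
    exact: aut_pow_null.
  by apply: negligibleU; exact: negligible_bigcup.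
apply/seteqP; split=> x.
- by move=> [[n|n] _ Ex]; [left|right]; exists n.
- by move=> [|] [n _ Ex]; [exists n%:Z|exists (Negz n)].
Qed.

Lemma ergodic_saturation E : ergodic T -> measurable E -> mu E != 0%E ->
  mu (~` saturation E) = 0%E.
Proof.
move=> ergT mE E0.
have TE : T @^-1` saturation E = saturation E.
  apply/seteqP; split=> x /= [k _ Ex].
  - by exists (k + 1) => //; rewrite /preimage/= aut_powD.
  - exists (k - 1) => //; rewrite /preimage/= (_ : T x = aut_pow T 1 x)//.
    by rewrite -aut_powD subrK.
have [||//] := ergT _ (measurable_saturation mE).
  by rewrite TE setYK measure0.
move=> s0; case/eqP: E0; apply: subset_measure0 s0 => //.
  exact: measurable_saturation.
by move=> x Ex; exists 0.
Qed.

(** By atomlessness, a non-null [W] has a subset [F] with [0 < mu F < mu W].  The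
saturation of [F] is conull by ergodicity, although it misses [W `\` F]. *)
Lemma wandering_null W : ergodic T -> atomless mu -> (mu W < +oo)%E ->
  measurable W ->
  (forall k x, W x -> W (aut_pow T k x) -> k = 0) -> mu W = 0%E.
Proof.
move=> ergT atm Wfin mW wW; apply: contrapT => /eqP; rewrite -measure_gt0.
move=> /(atm _ mW) [F [mF FW F0 FltW]].
have FWF : W `\` F `<=` ~` saturation F.
  move=> x [Wx nFx] [k _ Fx]; apply: nFx.
  by have k0 := wW k x Wx (FW _ Fx); move: Fx; rewrite k0.
have WF0 : mu (W `\` F) = 0%E.
  apply: subset_measure0 FWF (ergodic_saturation ergT mF _).
  - exact: measurableD.
  - exact/measurableC/measurable_saturation.
  - by rewrite gt_eqF.
have := measureDI mu mW mF.
rewrite [X in (X + _)%E]WF0 add0e (setIidr FW) => FW_eq.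
by move: FltW; rewrite [X in (_ < X)%E]FW_eq ltxx.
Qed.

(** On an orbit that meets [V], the visits to [U] all come after those to [V],
so there is a first one.  The first visits form a wandering set. *)
Lemma bounded_below_null U V : ergodic T -> atomless mu ->
  (mu setT < +oo)%E -> measurable U -> measurable V -> mu V != 0%E ->
  (forall (j : nat) x, U x -> ~ V (aut_pow T j x)) -> mu U = 0%E.
Proof.
move=> ergT atm mufin mU mV V0 UV.
pose W := U `\` \bigcup_(n : nat) aut_pow T (Negz n) @^-1` U.
have mW : measurable W.
  apply: measurableD => //; apply: bigcupT_measurable => n.
  exact: measurable_aut_pow_preimage.
have W0 : mu W = 0%E.
  apply: wandering_null => //.
    apply: le_lt_trans mufin; apply: le_measure; rewrite ?inE//.
  move=> [[//|k]|k] x [Ux nUx] [Uy nUy]; exfalso.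
  - apply: nUy; exists k => //; rewrite /preimage /mkset NegzE.
    by rewrite aut_powNK.
  - by apply: nUx; exists k.
apply: measure_negligible => //.
apply: (@negligibleS _ _ _ _ (saturation W `|` ~` saturation V)); last first.
  apply: negligibleU; apply/negligibleP.
  - exact: measurable_saturation.
  - exact: saturation_null.
  - exact/measurableC/measurable_saturation.
  - exact: ergodic_saturation.
move=> u Uu; have [[p _ Vp]|] := pselect (saturation V u); last by right.
(* The first visit to [U] is [T^(-n) u] for the largest [n] with [Q n]. *)
left; pose Q := fun n : nat => `[< U (aut_pow T (- n%:Z) u) >].
have Q0 : exists n, Q n by exists 0%N; apply/asboolP.
have Qle n : Q n -> (n <= `|p|)%N.
  move=> /asboolP Un; rewrite leqNgt; apply/negP => ltpn.
  have := UV (absz (n%:Z + p)) _ Un; apply; rewrite -aut_powD.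
  by rewrite (_ : _ + - n%:Z = p)//; lia.
case: (ex_maxnP Q0 Qle) => n /asboolP Qn maxn.
exists (- n%:Z) => //; split=> // -[m _ Um].
suff : Q (m.+1 + n)%N by move=> /maxn; rewrite addSn ltnNge leq_addl.
apply/asboolP; move: Um; rewrite /preimage /mkset -aut_powD.
by rewrite (_ : Negz m + - n%:Z = - (m.+1 + n)%N%:Z)//; lia.
Qed.

End powers.

(** * Involutions of the full group given by their displacement *)

Section displacement.
Context {d : measure_display} {X : measurableType d} {R : realType}.
Context {mu : {measure set X -> \bar R}} {T : aut mu} {c : X -> int}.
Hypothesis mc : forall k, measurable (c @^-1` [set k]).
(* This makes [x |-> T^(c x) x] an involution; asking that [c] record the way
   back as the opposite integer makes [Phi T c x] one too, even when the orbit
   of [x] is finite. *)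
Hypothesis cN : forall x, c (aut_pow T (c x) x) = - c x.

Let f x := aut_pow T (c x) x.

Let fK : cancel f f.
Proof. by move=> x; rewrite /f cN aut_powNK. Qed.

Let mf E : measurable E -> measurable (f @^-1` E).
Proof.
move=> mE.
rewrite (_ : _ @^-1` _ =
  \bigcup_k (c @^-1` [set k] `&` aut_pow T k @^-1` E)).
  apply: countable_bigcupT_measurable => // k; apply: measurableI => //.
  exact: measurable_aut_pow_preimage.
apply/seteqP; split=> x; first by move=> Ex; exists (c x).
by case=> k _ [/= <-].
Qed.

Let measurable_f : measurable_fun setT f.
Proof. by move=> _ E mE; rewrite setTI; exact: mf. Qed.

Let f_null E : measurable E -> mu E = 0%E -> mu (f @^-1` E) = 0%E.
Proof.
move=> mE E0; apply: measure_negligible; first exact: mf.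
apply: (@negligibleS _ _ _ _ (saturation T E)).
  by move=> x Ex; exists (c x).
apply/negligibleP; first exact: measurable_saturation.
exact: saturation_null.
Qed.

Let f_same_null : same_null_sets (pushforward mu f) mu.
Proof.
split=> E E0 F mF FE.
- by rewrite /pushforward f_null//; exact: E0.
- rewrite (_ : F = f @^-1` (f @^-1` F)); last first.
    by apply/seteqP; split=> x; rewrite /preimage/= fK.
  by apply: f_null; [exact: mf|exact: E0].
Qed.

Definition displacement_aut : aut mu :=
  Aut fK fK measurable_f measurable_f f_same_null.

Lemma measurable_displacement K : measurable (c @^-1` K).
Proof.
rewrite (_ : _ @^-1` _ = \bigcup_(k in K) c @^-1` [set k]).
  rewrite bigcup_mkcond; apply: countable_bigcupT_measurable => // k.
  by case: ifP.
by apply/seteqP; split=> x; [move=> Kx; exists (c x)|move=> [k Kk /= ->]].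
Qed.

Lemma PhiK x : involutive (Phi T c x).
Proof.
move=> n; rewrite {1}/Phi (_ : c _ = - c (aut_pow T n x)); last first.
  by rewrite /Phi addrC aut_powD cN.
by rewrite /Phi addrK.
Qed.

(** An integer sent across [0] while staying on its side of [p] lies between [0]
and [p], or its image does. *)
Lemma Phi_Sym (p : int) x :
  (forall n : int, n < p -> Phi T c x n < p) ->
  (forall n : int, p < n -> p < Phi T c x n) -> Sym_int_nat (Phi T c x).
Proof.
set s := Phi T c x => slt sgt.
have sK : involutive s := PhiK x.
split; first by exists s.
pose I := [set n : int | - `|p| <= n <= `|p|].
have finI : finite_set I.
  apply: (@sub_finite_set _ _
    ((fun i : nat => i%:Z - `|p|) @` [set i | (i < `|p|.*2.+1)%N])).
    by move=> n /= nI; exists (absz (n + `|p|)); move: nI; rewrite /I /=; lia.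
  exact/finite_image/finite_II.
apply: (@sub_finite_set _ _ (I `|` s @` I)); last first.
  by rewrite finite_setU; split=> //; exact: finite_image.
have key m : 0 <= m -> s m < 0 -> I m \/ I (s m).
  move=> m0 sm0; rewrite /I /=; have [mp|pm|pm] := ltgtP m p.
  - left; lia.
  - have := sgt _ pm; right; lia.
  - left; lia.
move=> m [[[n /= n0 <-] /negP]|[/= m0 nm]].
- rewrite -ltNge => /(key _ n0) [In|Isn]; last by left.
  by right; exists n.
- have sm0 : s m < 0.
    rewrite ltNge; apply/negP => sm0; apply: nm; exists (s m) => //.
  have [Im|Ism] := key _ m0 sm0; first by left.
  by right; exists (s m).
Qed.

End displacement.

(** * The greedy matching along orbits *)

Section matching.
Context {d : measure_display} {X : measurableType d} {R : realType}.
Context {mu : {measure set X -> \bar R}} (T : aut mu) (A B : set X).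

(** Stage [m] pairs each [x] of the first component with [T^(m+1) x] when the
latter is in the second, and removes the two: short distances go first, which is
what keeps pairs from straddling a point that remains free.  Recall that
[Negz m] is [- (m + 1)]. *)
Fixpoint free (n : nat) : set X * set X :=
  if n is m.+1 then
    ((free m).1 `\` aut_pow T m.+1 @^-1` (free m).2,
     (free m).2 `\` aut_pow T (Negz m) @^-1` (free m).1)
  else (A, B).

Definition source n := (free n).1 `&` aut_pow T n.+1 @^-1` (free n).2.
Definition target n := (free n).2 `&` aut_pow T (Negz n) @^-1` (free n).1.
Definition unmatched_left := \bigcap_n (free n).1.
Definition unmatched_right := \bigcap_n (free n).2.

Lemma free_sub m n : (m <= n)%N ->
  (free n).1 `<=` (free m).1 /\ (free n).2 `<=` (free m).2.
Proof.
elim: n => [|n IH]; first by rewrite leqn0 => /eqP ->; split.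
rewrite leq_eqVlt => /orP[/eqP ->|/IH [sA sB]]; first by split.
by split=> x [fx _]; [exact: sA|exact: sB].
Qed.

Lemma free_subA n : (free n).1 `<=` A.
Proof. by have [] := free_sub (leq0n n). Qed.

Lemma free_subB n : (free n).2 `<=` B.
Proof. by have [] := free_sub (leq0n n). Qed.

Lemma source_target n x : source n x -> target n (aut_pow T n.+1 x).
Proof.
by move=> [fx fy]; split=> //; rewrite /preimage /mkset NegzE aut_powNK.
Qed.

Lemma target_source n x : target n x -> source n (aut_pow T (Negz n) x).
Proof.
by move=> [fx fy]; split=> //; rewrite /preimage /mkset NegzE aut_powKN.
Qed.

Lemma target_preimage n : target n = aut_pow T (Negz n) @^-1` source n.
Proof.
apply/seteqP; split=> x; first exact: target_source.
by move=> /source_target; rewrite NegzE aut_powKN.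
Qed.

Lemma free_source_disj m n : (m < n)%N -> (free n).1 `&` source m = set0.
Proof.
move=> /free_sub[fA _]; apply/seteqP; split=> // x [/fA[_ nx] [_ fx]].
exact: nx.
Qed.

Lemma free_target_disj m n : (m < n)%N -> (free n).2 `&` target m = set0.
Proof.
move=> /free_sub[_ fB]; apply/seteqP; split=> // x [/fB[_ nx] [_ fx]].
exact: nx.
Qed.

Lemma source_inj m n x : source m x -> source n x -> m = n.
Proof.
wlog lt_mn : m n / (m < n)%N => [H sm sn|sm [fx _]].
  by have [mn|nm|//] := ltngtP m n; [exact: H|apply/esym/H].
have : ((free n).1 `&` source m) x by [].
by rewrite free_source_disj.
Qed.

Lemma target_inj m n x : target m x -> target n x -> m = n.
Proof.
wlog lt_mn : m n / (m < n)%N => [H sm sn|sm [fx _]].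
  by have [mn|nm|//] := ltngtP m n; [exact: H|apply/esym/H].
have : ((free n).2 `&` target m) x by [].
by rewrite free_target_disj.
Qed.

Lemma cover_left x : A x -> unmatched_left x \/ exists n, source n x.
Proof.
move=> Ax; have [|nex] := pselect (exists n, source n x); first by right.
left=> n _; elim: n => [//|n IH].
by split=> // fx; apply: nex; exists n.
Qed.

Lemma cover_right x : B x -> unmatched_right x \/ exists n, target n x.
Proof.
move=> Bx; have [|nex] := pselect (exists n, target n x); first by right.
left=> n _; elim: n => [//|n IH].
by split=> // fx; apply: nex; exists n.
Qed.

Section disjoint.
Hypothesis AB0 : A `&` B = set0.

Let disjAB x : A x -> B x -> False.
Proof. by move=> Ax Bx; have : (A `&` B) x by []; rewrite AB0. Qed.

(** For [j = 0] this is the disjointness of [A] and [B]; otherwise stage [j - 1]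
would have paired the two points. *)
Lemma free_no_unmatched n (j : nat) x : (free n).1 x -> (j <= n)%N ->
  ~ unmatched_right (aut_pow T j x).
Proof.
case: j => [|j] fx; first by move=> _ /(_ 0%N I); exact/disjAB/(free_subA fx).
by move=> /free_sub[/(_ _ fx) [_ nfx] _] /(_ j I).
Qed.

(** No matched pair straddles an unmatched point of [B]: its left end, free until
stage [n], would have been matched with that nearer point. *)
Lemma source_no_unmatched n (j : nat) x : source n x -> (j <= n.+1)%N ->
  ~ unmatched_right (aut_pow T j x).
Proof.
move=> sx; rewrite leq_eqVlt => /orP[/eqP -> Vx|]; last first.
  by rewrite ltnS; apply: free_no_unmatched; have [] := sx.
have : ((free n.+1).2 `&` target n) (aut_pow T n.+1 x).
  by split; [exact: Vx|exact: source_target].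
by rewrite free_target_disj.
Qed.

Definition displaced (k : int) : set X :=
  match k with
  | Posz 0 => set0
  | Posz n.+1 => source n
  | Negz n => target n
  end.

Definition displacement (x : X) : int := xget 0 [set k | displaced k x].

Lemma displaced_inj k l x : displaced k x -> displaced l x -> k = l.
Proof.
case: k l => [[//|m]|m] [[//|n]|n] /= sx tx.
- by rewrite (source_inj sx tx).
- by exfalso; apply: (@disjAB x);
    [exact: free_subA sx.1|exact: free_subB tx.1].
- by exfalso; apply: (@disjAB x);
    [exact: free_subA tx.1|exact: free_subB sx.1].
- by rewrite (target_inj sx tx).
Qed.

Lemma displacementE k x : displaced k x -> displacement x = k.
Proof.
move=> kx; rewrite /displacement; case: xgetP => [l _ lx|/(_ k)]; last by [].
exact: displaced_inj lx kx.
Qed.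

Lemma displacementP x :
  displaced (displacement x) x \/
  displacement x = 0 /\ forall k, ~ displaced k x.
Proof.
rewrite /displacement; case: xgetP => [l -> lx|nx]; first by left.
by right; split.
Qed.

Lemma displacement_outside x : ~ A x -> ~ B x -> displacement x = 0.
Proof.
move=> nA nB; have [|[]//] := displacementP x.
by case: (displacement x) => [[//|n]|n] [] => [/free_subA/nA|/free_subB/nB].
Qed.

Lemma displacement_unmatched_left x : unmatched_left x -> displacement x = 0.
Proof.
move=> Ux; have [|[]//] := displacementP x.
case: (displacement x) => [[//|n]|n] /= sx; exfalso.
- have : ((free n.+1).1 `&` source n) x by split; [exact: Ux|].
  by rewrite free_source_disj.
- by apply: (@disjAB x); [exact: (Ux 0%N)|exact: free_subB sx.1].
Qed.

Lemma displacedN k x : displaced k x -> displaced (- k) (aut_pow T k x).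
Proof.
case: k => [[//|n]|n]; first exact: source_target.
exact: target_source.
Qed.

Lemma displacementN x :
  displacement (aut_pow T (displacement x) x) = - displacement x.
Proof.
have [/displacedN/displacementE //|[cx0 _]] := displacementP x.
by rewrite cx0 oppr0.
Qed.

(** An unmatched [T^p x] separates the orbit: since no pair straddles it, the
permutation preserves both sides of [p]. *)
Lemma displacement_Sym x : saturation T unmatched_right x ->
  Sym_int_nat (Phi T displacement x).
Proof.
move=> [p _ Vp]; apply: (Phi_Sym displacementN (p := p)) => n np;
  rewrite /Phi; set c := displacement _.
- rewrite ltNge; apply/negP => cp.
  have := displacementP (aut_pow T n x); rewrite -/c => -[|[c0 _]]; last lia.
  case ec : c cp => [[|k]|k] cp; [lia| |lia] => /= sx.
  have := source_no_unmatched (j := absz (p - n)%R) sx; apply; first lia.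
  rewrite -aut_powD (_ : _ + n = p)//; lia.
- rewrite ltNge; apply/negP => cp.
  have := displacementP (aut_pow T n x); rewrite -/c => -[|[c0 _]]; last lia.
  case ec : c cp => [[|k]|k] cp; [lia|lia|] => /target_source sx.
  have := source_no_unmatched (j := absz (p - (n + Negz k))%R) sx.
  apply; first lia.
  rewrite -!aut_powD (_ : _ + n = p)//; lia.
Qed.

Hypotheses (mA : measurable A) (mB : measurable B).

Lemma measurable_free n : measurable (free n).1 /\ measurable (free n).2.
Proof.
elim: n => [//|n [mf1 mf2]].
by split; apply: measurableD => //; exact: measurable_aut_pow_preimage.
Qed.

Lemma measurable_source n : measurable (source n).
Proof.
have [m1 m2] := measurable_free n; apply: measurableI => //.
exact: measurable_aut_pow_preimage.
Qed.

Lemma measurable_target n : measurable (target n).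
Proof.
by rewrite target_preimage; apply/measurable_aut_pow_preimage/measurable_source.
Qed.

Lemma measurable_unmatched_left : measurable unmatched_left.
Proof. by apply: bigcapT_measurable => n; have [] := measurable_free n. Qed.

Lemma measurable_unmatched_right : measurable unmatched_right.
Proof. by apply: bigcapT_measurable => n; have [] := measurable_free n. Qed.

Lemma measurable_displacement_fiber k : measurable (displacement @^-1` [set k]).
Proof.
have mdisp l : measurable (displaced l).
  case: l => [[|n]|n]; first exact: measurable0.
  - exact: measurable_source.
  - exact: measurable_target.
have [->|k0] := eqVneq k 0; last first.
  rewrite (_ : _ @^-1` _ = displaced k)//; apply/seteqP; split=> x /=.
    move=> cx; move: k0; rewrite -cx.
    by have [//|[-> _]] := displacementP x; rewrite eqxx.
  exact: displacementE.
rewrite (_ : _ @^-1` _ = ~` \bigcup_l displaced l).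
  by apply/measurableC/countable_bigcupT_measurable.
apply/seteqP; split=> x /=.
- move=> c0 [l _ lx]; have := displacementE lx; rewrite c0 => l0.
  by move: lx; rewrite -l0.
- move=> nx; have [cx|[]//] := displacementP x.
  by case: nx; exists (displacement x).
Qed.

(** Otherwise [nu B] is the sum of the measures of the targets, which is the sum
of the measures of the sources, hence at most [nu A]. *)
Lemma unmatched_right_neq0 (nu : {measure set X -> \bar R}) :
  preserves nu T -> (nu A < nu B)%E -> nu unmatched_right != 0%E.
Proof.
move=> nuT; rewrite ltNge; apply: contra => /eqP V0.
apply: (@le_trans _ _ (nu (unmatched_right `|` \bigcup_n target n))).
  apply: le_measure; rewrite ?inE//.
    apply: measurableU; first exact: measurable_unmatched_right.
    by apply: bigcupT_measurable => n; exact: measurable_target.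
  by move=> x /cover_right[|[n nx]]; [left|right; exists n].
rewrite setUC measureU0//; last 2 first.
- by apply: bigcupT_measurable => n; exact: measurable_target.
- exact: measurable_unmatched_right.
rewrite measure_bigcup//=; last 2 first.
- by move=> n _; exact: measurable_target.
- by apply/trivIsetP => m n _ _ mn; apply/seteqP; split=> // x [tm tn];
    rewrite (target_inj tm tn) eqxx in mn.
rewrite (eq_eseriesr (g := fun n => nu (source n))); last first.
  move=> n _; rewrite target_preimage; apply: preserves_aut_pow => //.
  exact: measurable_source.
rewrite -(@measure_bigcup _ _ _ nu setT)//=; last 2 first.
- by move=> n _; exact: measurable_source.
- by apply/trivIsetP => m n _ _ mn; apply/seteqP; split=> // x [tm tn];
    rewrite (source_inj tm tn) eqxx in mn.
apply: le_measure; rewrite ?inE//.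
  by apply: bigcupT_measurable => n; exact: measurable_source.
by move=> x [n _ [/free_subA]].
Qed.

End disjoint.
End matching.

Theorem proposition5 (R : realType) (d : measure_display)
    (X : measurableType d) (mu : probability X R)
    (X_standard : standard_borel R X) (mu_atomless : atomless mu)
    (T : aut mu) (T_ergodic : ergodic T)
    (nu : {measure set X -> \bar R}) (nu_sigma_finite : sigma_finite setT nu)
    (nu_sim_mu : same_null_sets nu mu) (nu_T : preserves nu T)
    (A B : set X) (mA : measurable A) (mB : measurable B)
    (nuAB : (nu A < nu B)%E) :
  exists2 S : aut mu, com_full_group T S & mu.-negligible (S @` A `\` B).
Proof.
pose A' := A `\` B; pose B' := B `\` A.
have mA' : measurable A' by exact: measurableD.
have mB' : measurable B' by exact: measurableD.
have A'B' : A' `&` B' = set0.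
  by apply/seteqP; split=> // x [[Ax nBx] [Bx _]].
have nuA'B' : (nu A' < nu B')%E.
  have nuI : nu (A `&` B) \is a fin_num.
    rewrite ge0_fin_numE//; apply: le_lt_trans (lt_le_trans nuAB (leey _)).
    by apply: le_measure; rewrite ?inE//; exact: measurableI.
  move: nuAB; rewrite (measureDI nu mA mB) (measureDI nu mB mA).
  by rewrite [B `&` A]setIC lteD2rE.
pose c := displacement T A' B'; pose U := unmatched_left T A' B'.
pose V := unmatched_right T A' B'.
have mU : measurable U by exact: measurable_unmatched_left.
have mV : measurable V by exact: measurable_unmatched_right.
have V0 : mu V != 0%E.
  apply: contra_neq (unmatched_right_neq0 mA' mB' nu_T nuA'B') => V0.
  have /nu_sim_mu.1 nuV : mu.-null_set V by exact/measure0_null_setP.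
  exact: nuV.
have U0 : mu U = 0%E.
  apply: (@bounded_below_null _ _ _ _ T _ V) => //.
    by have := @probability_setT _ _ _ mu => /= ->; rewrite ltry.
  by move=> j x Ux; apply: (free_no_unmatched A'B' (Ux j I)).
pose mc := measurable_displacement_fiber T A'B' mA' mB'.
pose S := displacement_aut mc (displacementN T A'B').
exists S.
- split.
    by apply/aeW => x; exists (c x).
  exists c.
    by split; [exact: measurable_displacement|apply/aeW].
  exists (~` saturation T V); split.
  + exact/measurableC/measurable_saturation.
  + exact: ergodic_saturation.
  + move=> x nSx Vx; apply: nSx; exact: displacement_Sym.
- exists U; split=> // _ [[a Aa <-]] /= nB.
  have [A'a|nA'a] := pselect (A' a).
  + have [Ua|[n sn]] := cover_left T B' A'a.
      by move: nB; rewrite (displacement_unmatched_left A'B' Ua).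
    exfalso; apply: nB; rewrite (displacementE A'B' (k := n.+1) sn).
    by have [_ /free_subB[]] := sn.
  + have Ba : B a by apply: contrapT => nBa; exact: nA'a.
    exfalso; apply: nB; rewrite displacement_outside//.
    by case=> _; apply.
Qed.
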